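(* Let $n\ge2$, let $m$ be a positive integer, $r$ a non-negative integer, and $\alpha_1,\dots,\alpha_r$ non-zero complex numbers. In $\mathbb C^n$ with coordinates $(x_1,\dots,x_n)$ set \begin{align*} \Omega&:=\bigl\{e^{2\pi k\sqrt{-1}/m}\mid k=1,\dots,m\bigr\},\\ \mathcal A_c&:=\bigl\{\{x_i=\omega\alpha_j\}\mid \omega\in\Omega,\ i=1,\dots,n,\ j=1,\dots,r\bigr\},\\ \mathcal A_0&:=\bigl\{\{x_i=0\}\mid 1\le i\le n\bigr\},\\ \mathcal A'&:=\bigl\{\{x_i=\omega x_j\}\mid \omega\in\Omega,\ 1\le i<j\le n\bigr\}. \end{align*} Let $\mathcal A$ be one of the following arrangements: (a) $n=2$, $r\ge1$ and $\mathcal A=\bigl\{\{x_1=\omega x_2\}\mid\omega\in\Omega'\bigr\}\cup\mathcal A_c\cup\mathcal A_0$ with $1\in\Omega'\subset\Omega$; (b) $n\ge3$ and $\mathcal A=\mathcal A'\cup\mathcal A_c\cup\mathcal A_0$; (c) $n>3$, $m=1$, $r=0$ and $\mathcal A=\mathcal A'$. Assume that $\#L(\mathcal A)^{(2)}>1$. Let $v$ be a non-zero vector in $\mathbb C^n$ such that $\mathcal A$ is $v$-closed. Then: - If $r>0$ or $m>1$, then $v$ is a scalar multiple of one of the standard basis vectors $e_1,\dots,e_n$. - If $m=1$ and $\mathcal A=\mathcal A'\cup\mathcal A_0$, then $v$ is a scalar multiple of one of the $e_i$, or $v=(c,\dots,c)$ with $c\neq0$. - If $m=1$ and $\mathcal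 A=\mathcal A'$, then $v$ is a scalar multiple of one of the $e_i$ modulo $\mathbb C(1,\dots,1)$, i.e. $v=\lambda e_i+c(1,\dots,1)$ for some $i$ and some $\lambda,c\in\mathbb C$.
   Context: A hyperplane arrangement $\mathcal A$ in $V=\mathbb C^n$ is a finite set of affine hyperplanes. $L(\mathcal A)$ is the set of all non-empty intersections $\bigcap_{H\in\mathcal B}H$ with $\mathcal B\subset\mathcal A$ (the empty intersection being $V$), and $L(\mathcal A)^{(k)}$ is the set of elements of $L(\mathcal A)$ of codimension $k$. For a non-zero vector $v\in V$ and an affine subspace $S$, put $\langle v,S\rangle:=\{tv+y\mid t\in\mathbb C,\ y\in S\}$. $\mathcal A$ is called $v$-closed if $\langle v,S\rangle\in L(\mathcal A)$ for every $S\in L(\mathcal A)^{(2)}$. *)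

(* Defs.v *)
From HB Require Import structures.
From mathcomp Require Import all_boot all_order all_algebra.
From mathcomp Require Import all_classical all_reals all_analysis.
From mathcomp Require Import complex.

Set Implicit Arguments.
Unset Strict Implicit.
Unset Printing Implicit Defensive.

Import Order.TTheory GRing.Theory Num.Theory.

Local Open Scope classical_set_scope.
Local Open Scope ring_scope.
Local Open Scope complex_scope.

Section Arrangements.
Variables (F : fieldType) (n : nat).
Implicit Types (S : set 'rV[F]_n) (A B : set (set 'rV[F]_n)) (v : 'rV[F]_n).

(* L(A).  The intersection over B = set0 is the whole space. *)
Definition inter_poset A : set (set 'rV[F]_n) :=
  [set S | S !=set0 /\ exists2 B, B `<=` A & S = \bigcap_(H in B) H].

Definition affine_codim S (k : nat) : Prop :=
  exists (x : 'rV[F]_n) (U : {vspace 'rV[F]_n}),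
    S = [set y | y - x \in U] /\ (\dim U + k = n)%N.

Definition inter_poset_codim A (k : nat) : set (set 'rV[F]_n) :=
  [set S | inter_poset A S /\ affine_codim S k].

Definition sweep v S : set 'rV[F]_n :=
  [set t *: v + y | t in [set: F] & y in S].

Definition v_closed A v : Prop :=
  forall S, inter_poset_codim A 2 S -> inter_poset A (sweep v S).

Definition coord_hyp (i : 'I_n) (c : F) : set 'rV[F]_n :=
  [set x | x 0 i = c].

Definition diag_hyp (i j : 'I_n) (w : F) : set 'rV[F]_n :=
  [set x | x 0 i = w * x 0 j].

(* All the x_i = w x_j with w in W and i < j; for n = 2 the only such pair of
   indices is the pair of the two coordinates. *)
Definition diag_arr (W : set F) : set (set 'rV[F]_n) :=
  [set H | exists (w : F) (i j : 'I_n),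
     [/\ W w, (i < j)%N & H = diag_hyp i j w]].

Definition coord_arr0 : set (set 'rV[F]_n) :=
  [set H | exists i : 'I_n, H = coord_hyp i 0].

Definition coord_arr (W : set F) (r : nat) (alpha : 'I_r -> F) :
    set (set 'rV[F]_n) :=
  [set H | exists (w : F) (i : 'I_n) (j : 'I_r),
     W w /\ H = coord_hyp i (w * alpha j)].

End Arrangements.

Arguments coord_arr0 : clear implicits.
Arguments diag_arr {F} n W.
Arguments coord_arr {F} n W {r} alpha.

Definition cexp (R : realType) (z : R[i]) : R[i] :=
  (expR (complex.Re z))%:C * (cos (complex.Im z) +i* sin (complex.Im z)).

Definition Omega (R : realType) (m : nat) : set R[i] :=
  [set cexp (0 +i* (2 * pi * k%:R / m%:R)) |
     k in [set k : nat | (1 <= k <= m)%N]].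
Arguments Omega : clear implicits.

(* Main.v *)
(** If S is the intersection of two non-parallel members of A, the affine space
    <v, S> has codimension at least 1, so when A is v-closed some H in A
    contains S and is parallel to v.  The few hyperplanes of A through a
    well-chosen S then constrain v:
    - S = {x_i = a, x_j = 0} with a <> 0 gives v_i v_j = 0, which settles r > 0;
    - S = {x_i = 0, x_j = w x_k} gives v_i = 0 or v_j = w v_k for every w in
      Omega, and S = {x_i = x_j = 0} ties v_i to v_j, which settles (b) with r = 0;
    - in (c), S = {x_i = x_j = x_k} shows that v has at most two distinct
      entries, and S = {x_i = x_j, x_k = x_l} that one of them occurs once. *)
Require Import Defs.
From HB Require Import structures.
From mathcomp Require Import all_boot all_order all_algebra.
From mathcomp Require Import all_classical all_reals all_analysis.
From mathcomp Require Import complex.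

Set Implicit Arguments.
Unset Strict Implicit.
Unset Printing Implicit Defensive.

Import Order.TTheory GRing.Theory Num.Theory.

Local Open Scope classical_set_scope.
Local Open Scope card_scope.
Local Open Scope ring_scope.
Local Open Scope complex_scope.

Section VClosed.
Variables (F : fieldType) (n : nat).
Implicit Types (A : set (set 'rV[F]_n)) (v x y : 'rV[F]_n) (W : set F).

(** * Codimension-2 flats cut out by two independent forms, and their sweeps *)

Definition level2 (f g : 'rV[F]_n -> F) (a b : F) : set 'rV[F]_n :=
  [set x | f x = a /\ g x = b].

Section IndependentForms.
Variables (f g : 'rV[F]_n -> F) (p q : 'rV[F]_n).
Hypotheses (lf : scalar f) (lg : scalar g).
Hypotheses (fp : f p = 1) (gp : g p = 0) (fq : f q = 0) (gq : g q = 1).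

(** The vectors [p] and [q], dual to [f] and [g], witness the independence of the two forms: adding
    [s *: p + t *: q] shifts the two values independently. *)
Lemma form_combination (s t : F) x :
  f (s *: p + (t *: q + x)) = s + f x /\ g (s *: p + (t *: q + x)) = t + g x.
Proof. by rewrite !lf !lg fp fq gp gq !(mulr1, mulr0, add0r). Qed.

Lemma form0 : f 0 = 0 /\ g 0 = 0.
Proof.
by split; [have := lf (-1) 0 0|have := lg (-1) 0 0];
  rewrite scaler0 addr0 mulN1r addNr.
Qed.

Lemma level2_point (s t : F) : level2 f g s t (s *: p + (t *: q + 0)).
Proof.
have [f0 g0] := form0.
by rewrite /level2 /=; have [-> ->] := form_combination s t 0; rewrite f0 g0 !addr0.
Qed.

(** The level set is a translate of the kernel of x -> (f x, g x), which is onto F^2 thanks to [p]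
    and [q]; rank-nullity gives the codimension. *)
Lemma level2_codim (s t : F) : affine_codim (level2 f g s t) 2.
Proof.
pose h x : 'rV[F]_2 := \row_k (if k == 0 then f x else g x).
have hL : linear h.
  by move=> c x y; apply/rowP => k; rewrite !mxE; case: ifP; rewrite ?lf ?lg.
pose hm := GRing.isLinear.Build _ _ _ _ h hL.
pose h' : {linear 'rV[F]_n -> 'rV[F]_2} := HB.pack h hm.
have hE x : linfun h' x = h x by rewrite lfunE.
pose x0 := s *: p + (t *: q + 0).
have [fx0 gx0] := level2_point s t.
exists x0, (lker (linfun h')); split.
  apply/seteqP; split => y /=; rewrite memv_ker linearB /= !hE subr_eq0.
    by move=> [fy gy]; apply/eqP/rowP => k; rewrite !mxE fy gy fx0 gx0.
  move=> /eqP/rowP e; move: (e 0) (e 1).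
  by rewrite !mxE /= fx0 gx0.
have dim2 : \dim (limg (linfun h')) = 2%N.
  have -> : limg (linfun h') = fullv.
    apply/eqP; rewrite eqEsubv subvf /=; apply/subvP => w _.
    pose z := w 0 0 *: p + (w 0 1 *: q + 0).
    suff -> : w = linfun h' z by rewrite memv_img ?memvf.
    rewrite hE; apply/rowP => k; rewrite mxE.
    have [-> ->] := level2_point (w 0 0) (w 0 1).
    by case: ifP => [/eqP -> //|]; case: (unliftP 0 k) => [j ->|-> //] _;
      congr (w 0 _); rewrite ord1; apply/val_inj.
  by rewrite dimvf /dim /= mul1n.
by have := limg_ker_dim (linfun h') fullv; rewrite capfv dim2 dimvf /dim /= mul1n.
Qed.

Lemma sweep_level2_proper v (s t : F) : sweep v (level2 f g s t) <> setT.
Proof.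
move=> sT.
have [f0 g0] := form0.
(* If the sweep were the whole space, (f v, g v) alone would span F^2; (1,0) and (0,1) are not
   multiples of one vector. *)
have hit a b : exists c : F, a = c * f v /\ b = c * g v.
  have : sweep v (level2 f g s t) ((a + s) *: p + ((b + t) *: q + 0)).
    by rewrite sT.
  case=> c _ [y [fy gy] e]; exists c.
  have [] := form_combination (a + s) (b + t) 0.
  by rewrite -e lf lg fy gy f0 g0 !addr0 => /addIr -> /addIr ->.
have [c [/esym c1 /esym/eqP c2]] := hit 1 0.
have [d [_ d2]] := hit 0 1.
move: c2; rewrite mulf_eq0 => /orP[]/eqP z.
  by move/eqP: c1; rewrite z mul0r eq_sym oner_eq0.
by move/eqP: d2; rewrite z mulr0 oner_eq0.
Qed.

(* The sweep of a codimension-2 flat is a proper subspace, so the family of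
   hyperplanes cutting it out is non-empty; any member of it works. *)
Lemma v_closed_hyperplane A v (a b : F) :
  v_closed A v -> A [set x | f x = a] -> A [set x | g x = b] ->
  exists2 H, A H & forall (c : F) y, level2 f g a b y -> H (c *: v + y).
Proof.
move=> Av Af Ag.
have SL : inter_poset_codim A 2 (level2 f g a b).
  split; last exact: level2_codim.
  split; first by eexists; apply: level2_point.
  exists [set [set x | f x = a]; [set x | g x = b]].
    by move=> H /= [] ->.
  apply/seteqP; split => x /=.
    by move=> [fx gx] H [] ->.
  by move=> h; split; [apply: (h [set x | f x = a]); left
                      |apply: (h [set x | g x = b]); right].
have [_ [B BA e]] := Av _ SL.
have [B0|] := eqVneq B set0.
  by case: (@sweep_level2_proper v a b); rewrite e B0 bigcap_set0.
move=> /set0P [H BH]; exists H; first exact: BA.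
move=> c y Sy.
have : sweep v (level2 f g a b) (c *: v + y) by exists c => //; exists y.
by rewrite e; apply.
Qed.

End IndependentForms.

(** * Coordinate and diagonal hyperplanes as level sets of forms *)

Lemma diag_hypE (i j : 'I_n) (w : F) :
  diag_hyp i j w = [set x | x 0 i - w * x 0 j = 0].
Proof.
apply/seteqP; split => x; rewrite /diag_hyp /=; first by move=> ->; rewrite subrr.
by move=> /subr0_eq.
Qed.

Lemma diag_hypC (i j : 'I_n) : diag_hyp i j (1 : F) = diag_hyp j i 1.
Proof. by apply/seteqP; split => x /=; rewrite /diag_hyp /= !mul1r. Qed.

Lemma scalar_coord (i : 'I_n) : scalar (fun x : 'rV[F]_n => x 0 i).
Proof. by move=> c x y; rewrite !mxE. Qed.

Lemma scalar_diag (i j : 'I_n) (w : F) :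
  scalar (fun x : 'rV[F]_n => x 0 i - w * x 0 j).
Proof.
by move=> c x y; rewrite !mxE mulrDr opprD mulrBr addrACA [w * (c * _)]mulrCA.
Qed.

(** An upper bound on [A] with unrestricted constants [c], so that one notion serves all three types
    of arrangement. *)
Definition coord_or_diag W A := forall H, A H ->
  (exists i c, H = coord_hyp i c) \/ diag_arr n W H.

(** The hyperplane [H] found in [A] contains both [y0] and [v + y0] for a point [y0] of the flat;
    subtracting its equation at these two points shows that its linear part kills [v]. *)
Lemma v_closed_form W A v f g p q (a b : F) :
  coord_or_diag W A -> scalar f -> scalar g ->
  f p = 1 -> g p = 0 -> f q = 0 -> g q = 1 ->
  v_closed A v -> A [set x | f x = a] -> A [set x | g x = b] ->
  (exists i c, v 0 i = 0 /\ forall y, level2 f g a b y -> y 0 i = c) \/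
  exists w (i j : 'I_n), [/\ W w, (i < j)%N, v 0 i = w * v 0 j &
    forall y, level2 f g a b y -> y 0 i = w * y 0 j].
Proof.
move=> sA lf lg fp gp fq gq Av Af Ag.
have [H AH HS] := v_closed_hyperplane lf lg fp gp fq gq Av Af Ag.
have Hy y : level2 f g a b y -> H y by move/(HS 0); rewrite scale0r add0r.
have y0S := level2_point lf lg fp gp fq gq a b.
move: (_ + _) y0S (Hy _ y0S) (HS 1 _ y0S) => y0 _ Hy0; rewrite scale1r => Hv.
case: (sA _ AH) => [[i [c HE]]|[w [i [j [Ww ij HE]]]]]; [left|right];
  move: Hv Hy0 Hy; rewrite {}HE.
  rewrite /coord_hyp /= mxE => + e Hy; rewrite e => /eqP.
  by rewrite -subr_eq0 addrK => /eqP ?; exists i, c.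
rewrite /diag_hyp /= !mxE mulrDr => + e Hy.
by rewrite e => /addIr ?; exists w, i, j.
Qed.

(** * Constraints on [v] from each kind of pair of hyperplanes *)

Lemma delta_rowE (i j : 'I_n) : (delta_mx 0 i : 'rV[F]_n) 0 j = (j == i)%:R.
Proof. by rewrite mxE eqxx. Qed.

Lemma neq_ordW (i j : 'I_n) : (i < j)%N -> (i == j) = false.
Proof. by move=> ij; apply/negP => /eqP e; rewrite e ltnn in ij. Qed.

Lemma v_closed_coord_coord W A v (i j : 'I_n) (a b : F) :
  coord_or_diag W A -> ~ W 0 -> v_closed A v -> i != j ->
  A (coord_hyp i a) -> A (coord_hyp j b) ->
  [\/ v 0 i = 0, v 0 j = 0 |
      exists2 w, W w & (a = w * b /\ v 0 i = w * v 0 j) \/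
                       (b = w * a /\ v 0 j = w * v 0 i)].
Proof.
move=> sA W0 Av /negbTE ij Ai Aj.
have ji : (j == i) = false by rewrite eq_sym.
(* Coordinates other than [i] and [j] are free on the flat. Varying [z] shows that a hyperplane
   containing the flat involves no other index. *)
pose y z : 'rV[F]_n :=
  \row_l (if l == i then a else if l == j then b else z l).
have yS z : level2 (fun x => x 0 i) (fun x => x 0 j) a b (y z).
  by split; rewrite !mxE ?eqxx ?ji ?eqxx.
have [] := v_closed_form (p := delta_mx 0 i) (q := delta_mx 0 j) sA
  (scalar_coord i) (scalar_coord j) _ _ _ _ Av Ai Aj;
  rewrite ?delta_rowE ?eqxx ?ij ?ji //.
- move=> [k [c [vk /(_ _ (yS _)) H]]].
  have [e|ki] := eqVneq k i; first by constructor 1; rewrite -e.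
  have [e|kj] := eqVneq k j; first by constructor 2; rewrite -e.
  have := H (fun=> 1); rewrite -(H (fun=> 0)) !mxE (negbTE ki) (negbTE kj).
  by move/eqP; rewrite oner_eq0.
move=> [w [k [l [Ww kl vk /(_ _ (yS _)) H]]]].
(* With [w] non-zero, the equation x_k = w x_l really involves x_l, so [l] is confined to {i, j} as
   well. *)
have wn0 : w != 0 by apply/eqP => w0; apply: W0; rewrite -w0.
have kl' := neq_ordW kl; have lk' : (l == k) = false by rewrite eq_sym.
have kij : (k == i) || (k == j).
  apply/negP => /negP; rewrite negb_or => /andP[/negbTE ki /negbTE kj].
  have := H (fun t => (t == k)%:R); have := H (fun=> 0).
  rewrite !mxE ki kj eqxx lk' => <- /eqP.
  by rewrite oner_eq0.
have lij : (l == i) || (l == j).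
  apply/negP => /negP; rewrite negb_or => /andP[/negbTE li /negbTE lj].
  have := H (fun t => (t == l)%:R); have := H (fun=> 0).
  rewrite !mxE li lj eqxx kl' mulr0 mulr1 => -> /eqP.
  by rewrite eq_sym (negbTE wn0).
constructor 3; exists w => //.
have := H (fun=> 0); rewrite !mxE.
case/orP: kij vk kl' => /eqP ->; case/orP: lij => /eqP ->;
  rewrite ?eqxx // ?ji => ? _ ?; [left|right]; split => //.
Qed.

(** Since v_i is non-zero, the hyperplane found is not x_i = 0; the proof leaves x_j = w x_k as the
    only candidate through the flat. *)
Lemma v_closed_coord_diag W A v (i j k : 'I_n) (w : F) :
  coord_or_diag W A -> ~ W 0 -> v_closed A v ->
  i != j -> i != k -> (j < k)%N -> W w ->
  A (coord_hyp i 0) -> A (diag_hyp j k w) -> v 0 i != 0 ->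
  v 0 j = w * v 0 k.
Proof.
move=> sA W0 Av ij ik jk Ww Ai; rewrite diag_hypE => Ajk vi.
have nW0 u : W u -> u != 0 by move=> Wu; apply/eqP => u0; apply: W0; rewrite -u0.
have jk' := neq_ordW jk; have kj' : (k == j) = false by rewrite eq_sym.
have ji' : (j == i) = false by rewrite eq_sym (negbTE ij).
have ki' : (k == i) = false by rewrite eq_sym (negbTE ik).
pose S := level2 (fun x => x 0 i) (fun x => x 0 j - w * x 0 k) 0 0.
(* This point of the flat vanishes at [i] only, so no diagonal hyperplane involving x_i contains
   it. *)
pose y : 'rV[F]_n := \row_l (if l == i then 0 else if l == j then w else 1).
have yS : S y by split; rewrite !mxE ?eqxx ?ji' ?ki' ?kj' ?mulr1 ?subrr.
have y_neq0 l : l != i -> y 0 l != 0.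
  by move=> /negbTE li; rewrite mxE li; case: ifP; rewrite ?oner_eq0 ?nW0.
have S0 : S 0 by split; rewrite !mxE ?mulr0 ?subrr.
have SE l : l != i -> l != j -> l != k -> S (delta_mx 0 l).
  move=> /negbTE li /negbTE lj /negbTE lk; split; rewrite !delta_rowE ![_ == l]eq_sym.
    by rewrite li.
  by rewrite lj lk mulr0 subrr.
have [] := v_closed_form (p := delta_mx 0 i) (q := delta_mx 0 j) sA
  (scalar_coord i) (scalar_diag j k w) _ _ _ _ Av Ai Ajk;
  rewrite ?delta_rowE ?eqxx ?(negbTE ij) ?(negbTE ik) ?ji' ?ki' ?kj' ?mulr0 ?subr0 //.
- move=> [l [c [vl H]]].
  have li : l != i by apply/eqP => e; rewrite -e vl eqxx in vi.
  have := y_neq0 _ li.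
  by rewrite (H _ yS) -(H _ S0) mxE eqxx.
move=> [u [a [b [/nW0 u0 ab vab H]]]].
have ab' := neq_ordW ab; have ba' : (b == a) = false by rewrite eq_sym.
have ai : a != i.
  apply/eqP => ai; have := H _ yS; rewrite {1}ai [y 0 i]mxE eqxx => /esym/eqP.
  rewrite mulf_eq0 (negbTE u0) /=; apply/negP.
  by apply: y_neq0; rewrite -ai ba'.
have bi : b != i.
  apply/eqP => bi; have /eqP := H _ yS.
  rewrite bi [y 0 i]mxE eqxx mulr0; apply/negP.
  by apply: y_neq0; rewrite -bi ab'.
have ajk : (a == j) || (a == k).
  apply/negP => /negP; rewrite negb_or => /andP[aj ak].
  have := H _ (SE _ ai aj ak); rewrite !delta_rowE eqxx ba' mulr0.
  by move/eqP; rewrite oner_eq0.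
have bjk : (b == j) || (b == k).
  apply/negP => /negP; rewrite negb_or => /andP[bj bk].
  have := H _ (SE _ bi bj bk); rewrite !delta_rowE eqxx ab' mulr1.
  by move/esym/eqP; rewrite (negbTE u0).
(* At [y] the entries [j] and [k] are [w] and 1, which forces [u] = [w]; the order of the indices
   excludes the swapped pair. *)
have := H _ yS; move: vab ab ab'.
case/orP: ajk => /eqP ->; case/orP: bjk => /eqP ->; rewrite ?eqxx //.
- by move=> + _ _; rewrite !mxE eqxx ji' ki' kj' mulr1 => + ->.
- by move=> _ /ltnW; rewrite leqNgt jk.
Qed.

(* The flat is tested on the 0/1 vectors, i.e. on the indicators P. *)
Lemma v_closed_diag_diag A v (i j k l : 'I_n) :
  coord_or_diag [set 1] A -> v_closed A v ->
  i != j -> k != l -> i != k -> i != l -> k != j ->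
  A (diag_hyp i j 1) -> A (diag_hyp k l 1) ->
  exists a b : 'I_n, [/\ a != b, v 0 a = v 0 b &
    forall P : pred 'I_n, P i = P j -> P k = P l -> P a = P b].
Proof.
move=> sA Av ij kl ik il kj; rewrite !diag_hypE => Aij Akl.
have sym (a b : 'I_n) : a != b -> (a == b = false) * (b == a = false).
  by move=> /negbTE ab; rewrite [b == a]eq_sym ab.
have [ij1 ij2] := sym _ _ ij; have [kl1 kl2] := sym _ _ kl.
have [ik1 ik2] := sym _ _ ik; have [il1 il2] := sym _ _ il.
have [kj1 kj2] := sym _ _ kj.
pose y (P : pred 'I_n) : 'rV[F]_n := \row_t (P t)%:R.
pose S := level2 (fun x => x 0 i - 1 * x 0 j) (fun x => x 0 k - 1 * x 0 l) 0 0.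
have yS P : P i = P j -> P k = P l -> S (y P).
  by move=> e e'; split; rewrite !mxE ?e ?e' mul1r subrr.
(* The vectors e_i and e_k are dual to the two forms even when [l] equals [j], so concurrent and
   disjoint pairs are treated together. *)
have [] := v_closed_form (p := delta_mx 0 i) (q := delta_mx 0 k) sA
  (scalar_diag i j 1) (scalar_diag k l 1) _ _ _ _ Av Aij Akl;
  rewrite ?delta_rowE ?eqxx ?(ij1, ij2, kl1, kl2, ik1, ik2, il1, il2, kj1, kj2)
    ?mulr0 ?subr0 //.
- move=> [a [c [_ H]]]; exfalso.
  have := H _ (yS predT erefl erefl); rewrite -(H _ (yS pred0 erefl erefl)).
  by rewrite !mxE => /eqP; rewrite oner_eq0.
move=> [w [a [b [-> /neq_ordW/negbT ab vab H]]]]; exists a, b; split => //.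
  by rewrite vab mul1r.
move=> P e e'; have := H _ (yS _ e e'); rewrite !mxE mul1r => /eqP.
by case: (P a); case: (P b); rewrite ?oner_eq0 // eq_sym oner_eq0.
Qed.

(** Indicators of singletons place [a] and [b] among the four indices; those of {i, j} and {k, l}
    put them in the same pair. *)
Lemma v_closed_disjoint_diags A v (i j k l : 'I_n) :
  coord_or_diag [set 1] A -> v_closed A v -> uniq [:: i; j; k; l] ->
  A (diag_hyp i j 1) -> A (diag_hyp k l 1) ->
  v 0 i = v 0 j \/ v 0 k = v 0 l.
Proof.
move=> sA Av; rewrite /= !inE !negb_or -!andbA.
move=> /and5P[ij ik il jk /andP[jl /andP[kl _]]] Aij Akl.
have [|a [b [ab vab H]]] := v_closed_diag_diag sA Av ij kl ik il _ Aij Akl.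
  by rewrite eq_sym.
(* The indicator of an index outside the four satisfies both equations, so it cannot separate [a]
   from [b]. *)
have mem t : t \in [:: a; b] -> t \in [:: i; j; k; l].
  move=> tab; apply/negPn/negP; rewrite !inE !negb_or => /and4P[ti tj tk tl].
  have := H (pred1 t); rewrite /= ![_ == t]eq_sym (negbTE ti) (negbTE tj).
  rewrite (negbTE tk) (negbTE tl) => /(_ erefl erefl).
  move: tab ab; rewrite !inE => /orP[]/eqP ->; rewrite eqxx.
    by move=> /negbTE ->.
  by rewrite eq_sym => /negbTE ->.
have := mem a; have := mem b; rewrite !inE !eqxx orbT /= => /(_ isT) mb /(_ isT) ma.
have := H (pred2 i j); have := H (pred2 k l).
rewrite /= !eqxx ![k == _]eq_sym ![l == _]eq_sym.
rewrite ?(negbTE ij) (negbTE ik) (negbTE il) (negbTE jk) (negbTE jl) /= !orbT.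
move=> /(_ erefl erefl) Hkl /(_ erefl erefl) Hij.
move: vab ab Hij Hkl; case/or4P: ma => /eqP ->; case/or4P: mb => /eqP ->;
  rewrite ?eqxx ?(negbTE ij) ?(negbTE ik) ?(negbTE il) ?(negbTE jk) ?(negbTE jl) //=;
  rewrite ?orbT //; by [left | right].
Qed.

Lemma v_closed_concurrent_diags A v (i j k : 'I_n) :
  coord_or_diag [set 1] A -> v_closed A v -> uniq [:: i; j; k] ->
  A (diag_hyp i j 1) -> A (diag_hyp k j 1) ->
  [\/ v 0 i = v 0 j, v 0 j = v 0 k | v 0 k = v 0 i].
Proof.
move=> sA Av; rewrite /= !inE !negb_or -!andbA.
move=> /and4P[ij ik jk _] Aij Akj.
have [||a [b [ab vab H]]] := v_closed_diag_diag sA Av ij _ ik ij _ Aij Akj;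
  rewrite 1?eq_sym //.
have mem t : t \in [:: a; b] -> t \in [:: i; j; k].
  move=> tab; apply/negPn/negP; rewrite !inE !negb_or => /and3P[ti tj tk].
  have := H (pred1 t); rewrite /= ![_ == t]eq_sym (negbTE ti) (negbTE tj).
  rewrite (negbTE tk) => /(_ erefl erefl).
  move: tab ab; rewrite !inE => /orP[]/eqP ->; rewrite eqxx.
    by move=> /negbTE ->.
  by rewrite eq_sym => /negbTE ->.
have := mem a; have := mem b; rewrite !inE !eqxx orbT /= => /(_ isT) mb /(_ isT) ma.
move: vab ab; case/or3P: ma => /eqP ->; case/or3P: mb => /eqP ->;
  rewrite ?eqxx // => ? _; by [constructor 1|constructor 2|constructor 3].
Qed.

(** * Shapes of vectors, and the braid arrangement *)

Lemma exists_notin (s : seq 'I_n) : (size s < n)%N -> exists k, k \notin s.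
Proof.
move=> sn; apply: contrapT => /forallNP H.
suff : (#|'I_n| <= size s)%N by rewrite card_ord leqNgt sn.
rewrite cardE; apply: uniq_leq_size (enum_uniq _) _ => k _.
by apply/negPn/negP; apply: H.
Qed.

Lemma row_constant_off v (i : 'I_n) (c : F) :
  (forall j, j != i -> v 0 j = c) ->
  v = (v 0 i - c) *: delta_mx 0 i + const_mx c.
Proof.
move=> H; apply/rowP => j; rewrite !mxE eqxx /=.
by have [->|/H ->] := eqVneq j i; rewrite ?mulr1 ?subrK // mulr0 add0r.
Qed.

Lemma row_support1 v : v != 0 ->
  (forall i j, i != j -> v 0 i = 0 \/ v 0 j = 0) ->
  exists (i : 'I_n) (l : F), v = l *: delta_mx 0 i.
Proof.
move=> v0 H.
have /existsP[i vi] : [exists i, v 0 i != 0].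
  apply: contraNT v0; rewrite negb_exists => /forallP v0.
  by apply/eqP/rowP => i; rewrite mxE; apply/eqP/negPn/v0.
exists i, (v 0 i - 0); rewrite {1}(@row_constant_off v i 0); last first.
  by move=> j /H[//|] vi0; rewrite vi0 eqxx in vi.
by apply/rowP => j; rewrite !mxE addr0.
Qed.

Lemma braid_v_closed A v : (2 < n)%N -> A = diag_arr n [set 1] ->
  v_closed A v ->
  exists (i : 'I_n) (l c : F), v = l *: delta_mx 0 i + const_mx c.
Proof.
move=> n2 -> Av.
have sA : coord_or_diag [set 1] (diag_arr n [set (1 : F)]) by move=> H; right.
have Ad (i j : 'I_n) : i != j -> diag_arr n [set (1 : F)] (diag_hyp i j 1).
  move=> ij; have [lt_ij|le_ji] := ltnP i j; first by exists 1, i, j.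
  by rewrite diag_hypC; exists 1, j, i; split; rewrite // ltn_neqAle eq_sym ij.
(* Once v_i = v_k differs from v_j, the disjoint pairs {i, j} and {t, k} force v_t = v_k for every
   further [t], so only entry [j] is exceptional. *)
have step (i j k : 'I_n) : v 0 i != v 0 j -> v 0 k = v 0 i -> k != i ->
    exists (i : 'I_n) (l c : F), v = l *: delta_mx 0 i + const_mx c.
  move=> vij vki ki; exists j, (v 0 j - v 0 i), (v 0 i).
  apply: row_constant_off => t tj.
  have [-> //|ti] := eqVneq t i; have [-> //|tk] := eqVneq t k.
  have ij : i != j by apply: contraNneq vij => ->.
  have kj : k != j by apply: contraNneq vij => kj; rewrite -vki kj.
  have [|e|e] := v_closed_disjoint_diags sA Av _ (Ad i j ij) (Ad t k tk).
  - rewrite /= !inE !negb_or ij tk [i == t]eq_sym ti [i == k]eq_sym ki.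
    by rewrite [j == t]eq_sym tj eq_sym kj.
  - by rewrite e eqxx in vij.
  - by rewrite e.
have [/existsP[i /existsP[j vij]]|] := boolP [exists i, exists j, v 0 i != v 0 j].
  (* Concurrent diagonals make the entry of a third index [k] equal to v_i or to v_j; [step] applies
     either way. *)
  have [k] := exists_notin (s := [:: i; j]) n2.
  rewrite !inE negb_or => /andP[ki kj].
  have ij : i != j by apply: contraNneq vij => ->.
  have [|e|e|e] := v_closed_concurrent_diags sA Av _ (Ad i j ij) (Ad k j kj).
  - by rewrite /= !inE negb_or ij eq_sym ki eq_sym kj.
  - by rewrite e eqxx in vij.
  - by apply: (step j i k); rewrite // eq_sym.
  - exact: (step i j k).
rewrite negb_exists => /forallP vv.
pose i0 := Ordinal (ltnW (ltnW n2)); exists i0, 0, (v 0 i0).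
rewrite scale0r add0r; apply/rowP => i; rewrite mxE.
by have := vv i; rewrite negb_exists => /forallP /(_ i0) /negPn/eqP.
Qed.

(** * Arrangements containing all the coordinate hyperplanes *)

Section CoordinateHyperplanes.
Variables (W : set F) (A : set (set 'rV[F]_n)) (v : 'rV[F]_n).
Hypotheses (sA : coord_or_diag W A) (W0 : ~ W 0) (W1 : W 1).
Hypotheses (A0 : coord_arr0 F n `<=` A) (Av : v_closed A v).

(** For [w] in [W], neither a = w * 0 nor 0 = w * a can hold, so of any two entries of [v] one
    vanishes. *)
Lemma v_closed_shifted_coord (a : F) : a != 0 -> v != 0 ->
  (forall i, A (coord_hyp i a)) ->
  exists (i : 'I_n) (l : F), v = l *: delta_mx 0 i.
Proof.
move=> a0 v0 Aa; apply: row_support1 => // i j ij.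
have A0j : A (coord_hyp j 0) by apply: A0; exists j.
have [|| [w Ww]] := v_closed_coord_coord sA W0 Av ij (Aa i) A0j; [by left|by right|].
case=> [[/eqP]|[/esym/eqP]]; first by rewrite mulr0 (negbTE a0).
rewrite mulf_eq0 (negbTE a0) orbF => /eqP w0.
by case: W0; rewrite -w0.
Qed.

Hypothesis AW : diag_arr n W `<=` A.

Lemma v_closed_off_coord (i j k : 'I_n) (w : F) :
  W w -> v 0 i != 0 -> j != i -> k != i -> (j < k)%N -> v 0 j = w * v 0 k.
Proof.
move=> Ww vi ji ki jk; apply: (@v_closed_coord_diag W A v i) => //.
- by rewrite eq_sym.
- by rewrite eq_sym.
- by apply: A0; exists i.
- by apply: AW; exists w, j, k.
Qed.

(** For [w] = 1 the relation is symmetric, which removes the ordering of [j] and [k]. *)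
Lemma v_closed_equal_off (i j k : 'I_n) :
  v 0 i != 0 -> j != i -> k != i -> v 0 j = v 0 k.
Proof.
move=> vi ji ki; have [jk|kj|/val_inj -> //] := ltngtP j k.
  by rewrite (v_closed_off_coord W1 vi ji ki jk) mul1r.
by rewrite (v_closed_off_coord W1 vi ki ji kj) mul1r.
Qed.

(** If v_i is non-zero, the entries off [i] share one value; the diagonal for [w] relates two of
    them by the factor [w] different from 1, so this value is 0. *)
Lemma v_closed_nontrivial_diag (w : F) : (2 < n)%N -> W w -> w != 1 -> v != 0 ->
  exists (i : 'I_n) (l : F), v = l *: delta_mx 0 i.
Proof.
move=> n2 Ww w1 v0; apply: row_support1 => // i j ij.
have [->|vi] := eqVneq (v 0 i) 0; [by left|right].
have [k] := exists_notin (s := [:: i; j]) n2.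
rewrite !inE negb_or => /andP[ki kj]; rewrite eq_sym in ij.
have e := v_closed_equal_off vi ij ki.
have [jk|jk|/val_inj/eqP] := ltngtP j k; last by rewrite eq_sym (negbTE kj).
  have := v_closed_off_coord Ww vi ij ki jk.
  rewrite -e => /eqP; rewrite -{1}[v 0 j]mul1r -subr_eq0 -mulrBl mulf_eq0.
  by rewrite subr_eq0 eq_sym (negbTE w1) => /eqP.
have := v_closed_off_coord Ww vi ki ij jk.
rewrite -e => /eqP; rewrite -{1}[v 0 j]mul1r -subr_eq0 -mulrBl mulf_eq0.
by rewrite subr_eq0 eq_sym (negbTE w1) => /eqP.
Qed.

(** Two non-zero entries v_i and v_j are equal because of the flat x_i = x_j = 0, and the entries
    off [i] all equal v_j. *)
Lemma v_closed_trivial_diag : (2 < n)%N -> W `<=` [set 1] -> v != 0 ->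
  (exists (i : 'I_n) (l : F), v = l *: delta_mx 0 i) \/
  (exists2 c : F, c != 0 & v = const_mx c).
Proof.
move=> n2 WE v0.
have [H|] := boolP [forall i, forall j, (i != j) ==> ((v 0 i == 0) || (v 0 j == 0))].
  left; apply: row_support1 => // i j ij.
  by move/forallP/(_ i)/forallP/(_ j)/implyP/(_ ij)/orP: H => [] /eqP; [left|right].
case/forallPn => i /forallPn[j].
rewrite negb_imply negb_or => /and3P[ij vi vj]; right; exists (v 0 i) => //.
have Ac k : A (coord_hyp k 0) by apply: A0; exists k.
have vij : v 0 i = v 0 j.
  have [/eqP||[w /WE ->]] := v_closed_coord_coord sA W0 Av ij (Ac i) (Ac j).
  - by rewrite (negbTE vi).
  - by move/eqP; rewrite (negbTE vj).
  - by rewrite !mul1r => -[] [].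
apply/rowP => k; rewrite mxE vij; have [-> //|ki] := eqVneq k i.
by apply: v_closed_equal_off ki _ => //; rewrite eq_sym.
Qed.

End CoordinateHyperplanes.

End VClosed.

(** * Roots of unity in trigonometric form *)

Section RootsOfUnity.
Variable R : realType.

Lemma cexp_imag (t : R) : cexp (0 +i* t) = cos t +i* sin t.
Proof. by rewrite /cexp /= expR0 mul1r. Qed.

Lemma Omega_one m : (0 < m)%N -> Omega R m 1.
Proof.
(* The exponents run from 1 to [m], so 1 is obtained at [m], by a full turn. *)
move=> m0; exists m; first by rewrite /= m0 leqnn.
rewrite cexp_imag mulfK ?pnatr_eq0 -?lt0n //.
by rewrite mulrC mulr_natr cos2pi sin2pi.
Qed.

Lemma Omega_neq0 m : ~ Omega R m 0.
Proof.
case=> k _; rewrite cexp_imag => /eqP; rewrite eq_complex /= => /andP[/eqP c /eqP s].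
have := cos2Dsin2 (2 * pi * k%:R / m%:R : R).
by rewrite c s expr0n /= addr0 => /eqP; rewrite eq_sym oner_eq0.
Qed.

Lemma Omega1 : Omega R 1 = [set 1].
Proof.
apply/seteqP; split => w /=; last by move=> ->; apply: Omega_one.
case=> k /= k1 <-; have -> : k = 1%N by apply/eqP; rewrite eqn_leq andbC.
by rewrite cexp_imag divr1 mulr1 mulrC mulr_natr cos2pi sin2pi.
Qed.

Lemma Omega_nontrivial m : (1 < m)%N -> exists2 w, Omega R m w & w != 1.
Proof.
move=> m1; exists (cexp (0 +i* (2 * pi * 1%:R / m%:R))).
  by exists 1%N => //=; rewrite ltnW.
rewrite cexp_imag mulr1 eq_complex /= negb_and.
(* For [m] = 2 the root is -1, seen on its real part; for larger [m] the angle lies strictly between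
   0 and pi, so the imaginary part is positive. *)
have [->|m2] := eqVneq m 2%N.
  by rewrite mulrAC divff ?pnatr_eq0 // mul1r cospi -subr_eq0 -opprD oppr_eq0
    -(natrD _ 1 1) pnatr_eq0.
have m0 : (0 : R) < m%:R by rewrite ltr0n ltnW.
apply/orP; right; rewrite gt_eqF // sin_gt0_pi //.
rewrite divr_gt0 ?mulr_gt0 ?pi_gt0 //=.
rewrite ltr_pdivrMr // mulrC ltr_pM2l ?pi_gt0 // ltr_nat.
by rewrite ltn_neqAle eq_sym m2.
Qed.

End RootsOfUnity.

Theorem proposition4p1 (R : realType) (n m r : nat) (alpha : 'I_r -> R[i])
    (A : set (set 'rV[R[i]]_n)) (v : 'rV[R[i]]_n) :
  (2 <= n)%N -> (0 < m)%N -> (forall j, alpha j != 0) ->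
  [\/ [/\ n = 2%N, (1 <= r)%N &
        exists Omega' : set R[i],
          [/\ Omega' 1, Omega' `<=` Omega R m &
            A = diag_arr n Omega' `|` coord_arr n (Omega R m) alpha
                  `|` coord_arr0 R[i] n]],
      (3 <= n)%N /\
        A = diag_arr n (Omega R m) `|` coord_arr n (Omega R m) alpha
              `|` coord_arr0 R[i] n
    | [/\ (3 < n)%N, m = 1%N, r = 0%N & A = diag_arr n (Omega R m)]] ->
  `I_2 #<= inter_poset_codim A 2 ->
  v != 0 -> v_closed A v ->
  [/\ ((0 < r)%N \/ (1 < m)%N ->
         exists (i : 'I_n) (l : R[i]), v = l *: delta_mx 0 i),
      (m = 1%N -> A = diag_arr n (Omega R m) `|` coord_arr0 R[i] n ->
         (exists (i : 'I_n) (l : R[i]), v = l *: delta_mx 0 i) \/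
         (exists2 c : R[i], c != 0 & v = const_mx c))
    & (m = 1%N -> A = diag_arr n (Omega R m) ->
         exists (i : 'I_n) (l c : R[i]), v = l *: delta_mx 0 i + const_mx c)].
Proof.
move=> n2 m0 alpha0 cases _ v0 Av.
have O0 := @Omega_neq0 R m; have O1 := Omega_one R m0.
have weaken : (exists (i : 'I_n) (l : R[i]), v = l *: delta_mx 0 i) ->
    exists (i : 'I_n) (l c : R[i]), v = l *: delta_mx 0 i + const_mx c.
  by move=> [i [l ->]]; exists i, l, 0; rewrite raddf0 addr0.
have shape W B : B = diag_arr n W `|` coord_arr n (Omega R m) alpha
    `|` coord_arr0 R[i] n -> coord_or_diag W B.
  move=> -> H [[|[w [i [j [_ ->]]]]]|[i ->]]; first by right.
    by left; exists i, (w * alpha j).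
  by left; exists i, 0.
(* Stated for any [W], to serve both (a), where the diagonals use [Omega'], and (b). *)
have shifted W : ~ W 0 -> (0 < r)%N -> A = diag_arr n W
    `|` coord_arr n (Omega R m) alpha `|` coord_arr0 R[i] n ->
    exists (i : 'I_n) (l : R[i]), v = l *: delta_mx 0 i.
  move=> W0 r0 AE; pose j0 := Ordinal r0.
  apply: (v_closed_shifted_coord (shape _ _ AE) W0 _ Av (alpha0 j0) v0).
    by rewrite AE => H; right.
  by rewrite AE => i; left; right; exists 1, i, j0; rewrite mul1r.
case: cases => [[_ r0 [W [_ WO AE]]]|[n3 AE]|[n3 m1 r0 AE]].
- have vi := shifted W (fun W0 => O0 (WO _ W0)) r0 AE.
  by split => [//|_ _|_ _]; [left|exact: weaken].
- have A0 : coord_arr0 R[i] n `<=` A by rewrite AE => H; right.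
  have AO : diag_arr n (Omega R m) `<=` A by rewrite AE => H; left; left.
  have vm1 : m = 1%N -> (exists (i : 'I_n) (l : R[i]), v = l *: delta_mx 0 i) \/
      (exists2 c : R[i], c != 0 & v = const_mx c).
    move=> m1; apply: (v_closed_trivial_diag (shape _ _ AE)) => //.
    by rewrite m1 Omega1.
  split => [[r0|m1]|m1 _|m1 _]; first exact: shifted AE.
  + have [w Ow w1] := Omega_nontrivial R m1.
    exact: (v_closed_nontrivial_diag (shape _ _ AE) O0 O1 A0 Av AO n3 Ow w1 v0).
  + exact: vm1.
  + have [/weaken //|[c _ ->]] := vm1 m1.
    by exists (Ordinal (ltnW n2)), 0, c; rewrite scale0r add0r.
- rewrite m1 Omega1 in AE *.
  split => [|_ AE'|_ _]; first by rewrite r0 => -[].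
  (* In case (c) the arrangement has no coordinate hyperplane: the all-ones vector lies on every
     member of A' but on no x_i = 0. *)
  + have : A (coord_hyp (Ordinal (ltnW n2)) 0).
      by rewrite AE'; right; exists (Ordinal (ltnW n2)).
    rewrite AE => -[w [i [j [-> ij /seteqP[_ /(_ (const_mx 1))]]]]].
    rewrite /coord_hyp /diag_hyp /= !mxE mulr1 => /(_ erefl)/eqP.
    by rewrite oner_eq0.
  + exact: (braid_v_closed (ltnW n3) AE Av).
Qed.
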